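(* For every $\alpha\in(0,1)$ there exist a function $f:[0,1]\to\mathbb{R}$ with $f\notin C^\alpha[0,1]$, polynomials $q_n\in\mathcal{B}^+_n$ $(n\ge1)$ and a constant $C$ such that $$|f(x)-q_n(x)|\le C(\Delta_n(x))^\alpha\qquad\text{for all }x\in[0,1]\text{ and }n\ge1.$$
   Context: $\Delta_n(x)=\max\{\sqrt{x(1-x)/n},\,1/n\}$. $\mathcal{B}^+_n$ is the cone of polynomials of the form $\sum_{k=0}^n c_k\binom nk x^k(1-x)^{n-k}$ with all $c_k\ge0$. For $\alpha\in(0,1)$, $f\in C^\alpha[0,1]$ means $\sup_{x,y\in[0,1],|x-y|<h}|f(x)-f(y)|=O(h^{\alpha})$. *)

(* Defs.v *)
From mathcomp Require Import all_boot all_order all_algebra.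
From mathcomp Require Import all_classical all_reals all_analysis.
Set Implicit Arguments.
Unset Strict Implicit.
Unset Printing Implicit Defensive.
Import Order.TTheory GRing.Theory Num.Theory.
Import numFieldNormedType.Exports.
Local Open Scope classical_set_scope.
Local Open Scope ring_scope.

(* Functions on [0, 1] are total functions R -> R of which only the values on
   [0, 1] are ever used. *)

(* Meant for 1 <= n. *)
Definition Delta {R : realType} (n : nat) (x : R) : R :=
  Num.max (Num.sqrt (x * (1 - x) / n%:R)) (1 / n%:R).

Definition bernstein_cone {R : realType} (n : nat) : set {poly R} :=
  [set p | exists2 c : 'I_n.+1 -> R, (forall k, 0 <= c k) &
     p = \sum_(k < n.+1)
           (c k * 'C(n, k)%:R) *: ('X ^+ k * (1 - 'X) ^+ (n - k))].

(* The supremum is taken in the extended reals, so that it is +oo, and not a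
   default value, when f is unbounded. *)
Definition modulus {R : realType} (f : R -> R) (h : R) : \bar R :=
  ereal_sup [set e : \bar R | exists x y : R,
    [/\ x \in `[0, 1], y \in `[0, 1], `|x - y| < h & e = `|f x - f y|%:E]].

(* f is in C^alpha[0, 1]: modulus f h = O(h^alpha) as h tends to 0 from the
   right. *)
Definition holder_class {R : realType} (alpha : R) (f : R -> R) : Prop :=
  exists M : R, \forall h \near 0^'+, (modulus f h <= (M * h `^ alpha)%:E)%E.

(* Main.v *)
Require Import Defs.
From mathcomp Require Import all_boot all_order all_algebra.
From mathcomp Require Import all_classical all_reals all_analysis.
From mathcomp Require Import complex ring lra.
Import Order.TTheory GRing.Theory Num.Theory.
Import numFieldNormedType.Exports.
Local Open Scope classical_set_scope.
Local Open Scope ring_scope.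

(** Why positivity does not force smoothness of order [alpha].

    A polynomial with nonnegative Bernstein coefficients of degree [n] is
    rigid, but the constant [1] plus a small perturbation is not: the
    perturbation may have Bernstein coefficients as large as [1].  A bounded
    oscillation with Bernstein coefficients of size [exp L] is allowed to
    oscillate [sqrt L] times faster than the scale [n ^ -1/2] of the
    approximation, and once multiplied by [n ^ (- alpha / 2)] its coefficients
    are negligible as soon as [n] is large compared with [exp L].

    The oscillation is [Im ((1 + i t (1 - 2 x)) ^ m)] with [m t ^ 2 = 2 L].
    Since [1 + i t (1 - 2 x) = (1 - i t) x + (1 + i t) (1 - x)], the binomial
    formula displays its Bernstein coefficients, of modulus at most
    [(1 + t ^ 2) ^ (m / 2) <= exp L].  It grows like [exp (L (1 - 2 x) ^ 2)]
    away from the middle of the interval, and the factor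
    [(4 x (1 - x)) ^ (L + 1)] brings it back below [4 x (1 - x)], at the cost
    of a factor [4 ^ (L + 1)] on the coefficients.  Near [x = 1/2] it moves by
    a fixed amount over a distance [u] of order [(L m) ^ -1/2].  With the
    amplitude [n ^ (- alpha / 2)], where [n = m + 2 (L + 1)] is the degree,
    this is an increment of at least [K u ^ alpha], with [K] of order
    [L ^ (alpha / 2)], hence arbitrarily large: this is [hump].

    The function is a sum of such humps with rapidly increasing degrees,
    started at the constant [1].  Each hump takes at most half of the margin
    of positivity that is left, and its sign is chosen so that its increment
    at [1/2] is not cancelled by the previous ones ([next_stage_ex]).  The
    partial sum consisting of the humps of degree at most [n] serves as [q n];
    the humps left out add up to at most
    [2 x (1 - x) n ^ (- alpha / 2) <= 2 (Delta n x) ^ alpha]. *)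

Set Implicit Arguments.
Unset Strict Implicit.

(** * The cone of polynomials with nonnegative Bernstein coefficients *)

Lemma coneD (R : realType) (d : nat) (p q : {poly R}) :
  bernstein_cone d p -> bernstein_cone d q -> bernstein_cone d (p + q).
Proof.
move=> [c c0 ->] [e e0 ->]; exists (fun k => c k + e k).
  by move=> k; rewrite addr_ge0.
by rewrite -big_split; apply: eq_bigr => k _; rewrite mulrDl scalerDl.
Qed.

Lemma cone_sum (R : realType) (d : nat) (I : Type) (r : seq I)
    (F : I -> {poly R}) :
  (forall i, bernstein_cone d (F i)) -> bernstein_cone d (\sum_(i <- r) F i).
Proof.
move=> Fc; elim/big_ind : _ => // [|p q]; last exact: coneD.
exists (fun=> 0) => //; rewrite big1// => k _.
by rewrite mul0r scale0r.
Qed.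

Lemma coneZ (R : realType) (d : nat) (a : R) (p : {poly R}) :
  0 <= a -> bernstein_cone d p -> bernstein_cone d (a *: p).
Proof.
move=> a0 [c c0 ->]; exists (fun k => a * c k).
  by move=> k; rewrite mulr_ge0.
by rewrite scaler_sumr; apply: eq_bigr => k _; rewrite scalerA mulrA.
Qed.

Lemma cone_monomial (R : realType) (d k : nat) : (k <= d)%N ->
  bernstein_cone d ('X ^+ k * (1 - 'X) ^+ (d - k) : {poly R}).
Proof.
move=> kd; exists (fun j => (j == inord k)%:R / 'C(d, k)%:R).
  by move=> j; rewrite divr_ge0.
rewrite (bigD1 (inord k)) //= eqxx inordK// mul1r mulVf ?scale1r; last first.
  by rewrite pnatr_eq0 -lt0n bin_gt0.
rewrite big1 ?addr0// => j /negbTE ->.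
by rewrite mul0r mul0r scale0r.
Qed.

Lemma cone_mulX (R : realType) (d : nat) (p : {poly R}) :
  bernstein_cone d p -> bernstein_cone d.+1 ('X * p).
Proof.
move=> [c c0 ->]; rewrite mulr_sumr; apply: cone_sum => k.
rewrite -scalerAr mulrA -exprS -subSS; apply: coneZ; first by rewrite mulr_ge0.
exact/cone_monomial/ltn_ord.
Qed.

Lemma cone_mul1BX (R : realType) (d : nat) (p : {poly R}) :
  bernstein_cone d p -> bernstein_cone d.+1 ((1 - 'X) * p).
Proof.
move=> [c c0 ->]; rewrite mulr_sumr; apply: cone_sum => k.
rewrite -scalerAr mulrCA -exprS -subSn; last by rewrite -ltnS.
by apply: coneZ; [rewrite mulr_ge0|exact/cone_monomial/ltnW/ltn_ord].
Qed.

(** Degree elevation, from [p = 'X * p + (1 - 'X) * p]. *)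
Lemma cone_elevation (R : realType) (d e : nat) (p : {poly R}) : (d <= e)%N ->
  bernstein_cone d p -> bernstein_cone e p.
Proof.
move=> /subnKC <-; elim: (e - d)%N => [|j IH] pc; first by rewrite addn0.
rewrite addnS (_ : p = 'X * p + (1 - 'X) * p); last by ring.
by apply: coneD; [apply: cone_mulX|apply: cone_mul1BX]; apply: IH.
Qed.

Lemma coneC (R : realType) (d : nat) (a : R) :
  0 <= a -> bernstein_cone d a%:P.
Proof.
move=> a0; apply: (@cone_elevation R 0) => //.
rewrite -[a]mulr1 polyCM mul_polyC; apply: coneZ => //.
by have := cone_monomial R (leqnn 0); rewrite !expr0 mulr1.
Qed.

(** The Bernstein coefficients of degree [d] of [p] all lie in [[- M, M]]; this
    form lets every bound be derived from the closure properties of the cone. *)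
Definition bernstein_bounded (R : realType) (d : nat) (M : R) (p : {poly R}) :=
  bernstein_cone d (M%:P + p) /\ bernstein_cone d (M%:P - p).

Lemma bernstein_bounded_sum (R : realType) (d : nat) (M : R) (c : nat -> R) :
  (forall k, (k <= d)%N -> `|c k| <= M) ->
  bernstein_bounded d M
    (\sum_(k < d.+1) (c k * 'C(d, k)%:R) *: ('X ^+ k * (1 - 'X) ^+ (d - k))).
Proof.
move=> cM; rewrite /bernstein_bounded.
have -> : M%:P = \sum_(k < d.+1)
    (M * 'C(d, k)%:R) *: ('X ^+ k * (1 - 'X) ^+ (d - k)) :> {poly R}.
  (* The coefficients of a constant are all equal to it. *)
  transitivity (M *: ((1 - 'X) + 'X) ^+ d : {poly R}).
    by rewrite subrK expr1n -mul_polyC mulr1.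
  rewrite exprDn scaler_sumr; apply: eq_bigr => k _.
  by rewrite -scalerA scaler_nat [_ * 'X^_]mulrC.
split; rewrite -?sumrB -?big_split /=.
- exists (fun k => M + c k) => [k|].
    have := cM k; rewrite -ltnS ltn_ord => /(_ isT); rewrite ler_norml; lra.
  by apply: eq_bigr => k _; rewrite mulrDl scalerDl.
- exists (fun k => M - c k) => [k|].
    have := cM k; rewrite -ltnS ltn_ord => /(_ isT); rewrite ler_norml; lra.
  by apply: eq_bigr => k _; rewrite mulrBl scalerBl.
Qed.

Lemma bernstein_boundedZ (R : realType) (d : nat) (M a : R) (p : {poly R}) :
  0 <= a -> bernstein_bounded d M p -> bernstein_bounded d (a * M) (a *: p).
Proof.
move=> a0 [p1 p2]; rewrite /bernstein_bounded polyCM mul_polyC.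
by rewrite -scalerDr -scalerBr; split; apply: coneZ.
Qed.

(** [4M + 4x(1-x)p = 4x(1-x)(M + p) + 4M(1 - x(1-x))], and the last factor is
    [x^2 + x(1-x) + (1-x)^2]. *)
Lemma bernstein_bounded_bump (R : realType) (d : nat) (M : R) (p : {poly R}) :
  0 <= M -> bernstein_bounded d M p ->
  bernstein_bounded d.+2 (4 * M) (4 *: ('X * (1 - 'X)) * p).
Proof.
move=> M0 pM.
have key q : bernstein_cone d (M%:P + q) ->
    bernstein_cone d.+2 ((4 * M)%:P + 4 *: ('X * (1 - 'X)) * q).
  move=> qM; have -> : (4 * M)%:P + 4 *: ('X * (1 - 'X)) * q =
    4 *: ('X * ((1 - 'X) * (M%:P + q)) + M *: ('X * ('X * 1%:P)
       + 'X * ((1 - 'X) * 1%:P) + (1 - 'X) * ((1 - 'X) * 1%:P))) :> {poly R}.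
    rewrite -!mul_polyC polyCM; ring.
  have C1 : bernstein_cone d (1%:P : {poly R}) by apply: coneC.
  apply: coneZ => //; apply: coneD; first exact/cone_mulX/cone_mul1BX.
  apply: coneZ => //; apply: coneD; first apply: coneD.
  - exact/cone_mulX/cone_mulX.
  - exact/cone_mulX/cone_mul1BX.
  - exact/cone_mul1BX/cone_mul1BX.
by case: pM => p1 p2; split; [|rewrite -mulrN]; apply: key.
Qed.

(** * A fast oscillation with controlled Bernstein coefficients *)

Definition sqnormc (R : rcfType) (z : R[i]) : R :=
  complex.Re z ^+ 2 + complex.Im z ^+ 2.

Lemma sqnormcM (R : rcfType) (u v : R[i]) :
  sqnormc (u * v) = sqnormc u * sqnormc v.
Proof. by case: u v => [a b] [c d]; rewrite /sqnormc /=; ring. Qed.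

Lemma sqnormcX (R : rcfType) (z : R[i]) (n : nat) :
  sqnormc (z ^+ n) = sqnormc z ^+ n.
Proof.
elim: n => [|n IH]; last by rewrite !exprS sqnormcM IH.
by rewrite !expr0 /sqnormc /= expr0n expr1n addr0.
Qed.

Definition oscillation_coef (R : rcfType) (m : nat) (t : R) (k : nat) : R :=
  complex.Im ((1 -i* t) ^+ k * (1 +i* t) ^+ (m - k))%C.

(** The polynomial [Im ((1 + i t (1 - 2 x)) ^ m)], given by its Bernstein
    coefficients; see [oscillationE]. *)
Definition oscillation (R : rcfType) (m : nat) (t : R) : {poly R} :=
  \sum_(k < m.+1) (oscillation_coef m t k * 'C(m, k)%:R) *:
    ('X ^+ k * (1 - 'X) ^+ (m - k)).

(** The binomial formula for
    [1 + i t (1 - 2 x) = (1 - i t) x + (1 + i t) (1 - x)]. *)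
Lemma oscillationE (R : rcfType) (m : nat) (t x : R) :
  (oscillation m t).[x] = complex.Im ((1 +i* (t * (1 - 2 * x))) ^+ m)%C.
Proof.
have -> : (1 +i* (t * (1 - 2 * x)) =
    (1 +i* t) * (1 - x)%:C + (1 -i* t) * x%:C)%C.
  by rewrite /=; congr (_ +i* _)%C; ring.
rewrite exprDn raddf_sum horner_sum; apply: eq_bigr => k _ /=.
rewrite !hornerE /=.
rewrite raddfMn /= !exprMn -!rmorphXn /= /oscillation_coef.
set u := (_ ^+ k)%C; set v := (_ ^+ (m - k))%C.
rewrite -[RHS]mulr_natr; move: (x ^+ k) ((1 - x) ^+ _) (_%:R) => p q r.
by case: u v => [a b] [c d] /=; ring.
Qed.

Lemma normr_Im_le (R : rcfType) (z : R[i]) (a : R) :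
  0 <= a -> sqnormc z <= a ^+ 2 -> `|complex.Im z| <= a.
Proof.
move=> a0 za; rewrite -ler_sqr ?nnegrE// real_normK ?num_real//.
by apply: le_trans za; rewrite /sqnormc lerDr sqr_ge0.
Qed.

Lemma expr1D_le_expR (R : realType) (m : nat) (s L : R) :
  0 <= s -> m%:R * s = 2 * L -> (1 + s) ^+ m <= expR L ^+ 2.
Proof.
move=> s0 msL; rewrite -expRM_natl -[2%:R]/(2 : R) -msL expRM_natl.
by apply: lerXn2r; rewrite ?nnegrE ?expR_ge0 ?addr_ge0// expR_ge1Dx.
Qed.

Lemma oscillation_bounded (R : realType) (m : nat) (t L : R) :
  m%:R * t ^+ 2 = 2 * L -> bernstein_bounded m (expR L) (oscillation m t).
Proof.
move=> tL; apply: bernstein_bounded_sum => k km.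
apply: normr_Im_le; first exact: expR_ge0.
rewrite sqnormcM !sqnormcX {1 2}/sqnormc /= sqrrN -exprD subnKC// expr1n.
exact: expr1D_le_expR (sqr_ge0 _) tL.
Qed.

Lemma oscillation_le (R : realType) (m : nat) (t L x : R) :
  m%:R * t ^+ 2 = 2 * L ->
  `|(oscillation m t).[x]| <= expR (L * (1 - 2 * x) ^+ 2).
Proof.
move=> tL; rewrite oscillationE; apply: normr_Im_le; first exact: expR_ge0.
rewrite sqnormcX {1}/sqnormc /= expr1n.
by apply: expr1D_le_expR (sqr_ge0 _) _; ring: tL.
Qed.

Lemma oscillation_half (R : realType) (m : nat) (t : R) :
  (oscillation m t).[2^-1] = 0.
Proof.
rewrite oscillationE divff ?pnatr_eq0// subrr mulr0.
by rewrite (_ : (1 +i* 0)%C = 1)// expr1n.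
Qed.

(** The argument of [(1 + i b) ^ m] is close to [m b], so that its imaginary
    part is at least [m b / 2] as long as [m b] is small.  The induction also
    controls the real part, which times [b] is the increment of the imaginary
    part. *)
Lemma Im_expr_ge (R : realType) (m : nat) (b : R) :
  0 <= b -> m%:R * b <= 2^-1 ->
  m%:R * b / 2 <= complex.Im ((1 +i* b)%C ^+ m).
Proof.
move=> b0.
suff IH : m%:R * b <= 2^-1 ->
  [/\ 1 - (m%:R * b) ^+ 2 <= complex.Re ((1 +i* b)%C ^+ m) <= 1,
      m%:R * b / 2 <= complex.Im ((1 +i* b)%C ^+ m) &
      complex.Im ((1 +i* b)%C ^+ m) <= m%:R * b].
  by move=> /IH[].
elim: m => [|m IH]; first by rewrite expr0 !mul0r expr0n subr0 /= !lexx.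
rewrite (exprS (_ +i* _)%C) -natr1 mulrDl mul1r => mb.
have c0 : 0 <= m%:R * b by rewrite mulr_ge0.
have := IH ltac:(lra); case: (_ ^+ m) => p r /=.
set c := m%:R * b in mb c0 *; rewrite ?mul1r.
move=> [/andP[p1 p2] r1 r2].
have br0 : 0 <= b * r by rewrite mulr_ge0//; lra.
have brc : b * r <= b * c by rewrite ler_wpM2l.
have bp1 : b * p <= b by rewrite -[leRHS]mulr1 ler_wpM2l.
have c4 : c ^+ 2 <= 4^-1 by nra.
have bp2 : b / 2 <= b * p by apply: ler_wpM2l => //; lra.
have b2 : 0 <= b ^+ 2 by apply: sqr_ge0.
have bc : 0 <= b * c by rewrite mulr_ge0.
split; [apply/andP; split|..]; rewrite ?mul1r -/c; nra.
Qed.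

(** * Humps *)

Lemma bernoulli_ineq (R : realDomainType) (k : nat) (h : R) :
  0 <= h <= 1 -> 1 - k%:R * h <= (1 - h) ^+ k.
Proof.
move=> /andP[h0 h1]; elim: k => [|k IH]; first by rewrite expr0 mul0r subr0.
rewrite exprS -natr1.
have kh : 0 <= k%:R * h * h by rewrite !mulr_ge0.
have := ler_wpM2l (_ : 0 <= 1 - h) IH; rewrite subr_ge0 => /(_ h1); lra.
Qed.

Lemma nat_powR_large (R : realType) (gam B : R) : 0 < gam ->
  exists N, forall n, (N <= n)%N -> B <= n%:R `^ gam.
Proof.
move=> gam0; exists (Num.bound (Num.max B 0 `^ gam^-1)) => n Nn.
apply: (@le_trans _ _ (Num.max B 0)); first by rewrite le_max lexx.
have B0 : 0 <= Num.max B 0 by rewrite le_max lexx orbT.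
have -> : Num.max B 0 = (Num.max B 0 `^ gam^-1) `^ gam.
  by rewrite -powRrM mulVf ?powRr1// gt_eqF.
apply: ge0_ler_powR; rewrite ?nnegrE ?powR_ge0 ?(ltW gam0)//.
apply/ltW/(lt_le_trans (archi_boundP (powR_ge0 _ _))).
by rewrite ler_nat.
Qed.

Lemma bernstein_bounded_bumpX (R : realType) (d l : nat) (M : R)
    (p : {poly R}) : 0 <= M -> bernstein_bounded d M p ->
  bernstein_bounded (d + l.*2) (4 ^+ l * M) ((4 *: ('X * (1 - 'X))) ^+ l * p).
Proof.
move=> M0 pM; elim: l => [|l IH]; first by rewrite !expr0 !mul1r addn0.
rewrite !exprS -!mulrA doubleS !addnS; apply: bernstein_bounded_bump => //.
by rewrite mulr_ge0.
Qed.

Lemma bernstein_boundedW (R : realType) (d e : nat) (M M' : R) (p : {poly R}) :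
  (d <= e)%N -> M <= M' -> bernstein_bounded d M p -> bernstein_bounded e M' p.
Proof.
move=> de MM' [p1 p2].
have C : bernstein_cone d (M' - M)%:P by apply: coneC; rewrite subr_ge0.
have E q : M'%:P + q = (M' - M)%:P + (M%:P + q).
  by rewrite polyCB addrA subrK.
by rewrite /bernstein_bounded !E; split; apply/(cone_elevation de)/coneD.
Qed.

(** With [y = 4 x (1 - x)], one has [(1 - 2 x) ^ 2 = 1 - y], and [L] of the
    [L + 1] factors [y] absorb the growth of the oscillation because
    [y * exp (1 - y) <= 1]; the last one remains in the bound. *)
Lemma bump_oscillation_le (R : realType) (L m : nat) (t x : R) :
  m%:R * t ^+ 2 = 2 * L%:R -> 0 <= x <= 1 ->
  `|((4 *: ('X * (1 - 'X))) ^+ L.+1 * oscillation m t).[x]| <= 4 * (x * (1 - x)).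
Proof.
move=> tL /andP[x0 x1].
set y := 4 * (x * (1 - x)).
have y0 : 0 <= y by rewrite !mulr_ge0// subr_ge0.
have yE : (4 *: ('X * (1 - 'X))).[x] = y.
  by rewrite hornerZ hornerM hornerD hornerN hornerX hornerC.
rewrite hornerM horner_exp yE.
rewrite normrM ger0_norm ?exprn_ge0// exprS -mulrA ler_piMr//.
apply: le_trans (_ : y ^+ L * expR (L%:R * (1 - 2 * x) ^+ 2) <= 1).
  by rewrite ler_wpM2l ?exprn_ge0// oscillation_le.
rewrite expRM_natl -exprMn exprn_ile1//; first by rewrite (mulr_ge0 y0) ?expR_ge0.
have -> : (1 - 2 * x) ^+ 2 = 1 - y by rewrite /y; ring.
have := expR_ge1Dx (y - 1); rewrite addrC subrK => /(ler_wpM2r (expR_ge0 (1 - y))).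
by rewrite -expRD (_ : y - 1 + (1 - y) = 0) ?expR0//; ring.
Qed.

(** The degree [n] can be taken arbitrarily large, the constant [K] arbitrarily
    large and the coefficient bound [eps] arbitrarily small, all independently:
    [L] is chosen first, according to [K], and then [m] according to [L], [eps]
    and the lower bound on [n]. *)
Lemma hump (R : realType) (gam : R) (N : nat) (K eps : R) :
  0 < gam -> 0 < eps ->
  exists (n : nat) (phi : {poly R}) (u : R),
    [/\ (N <= n)%N, 0 < u <= 2^-1, u <= eps, bernstein_bounded n eps phi &
    [/\ forall x, 0 <= x <= 1 -> `|phi.[x]| <= x * (1 - x) * n%:R^-1 `^ gam,
        phi.[2^-1] = 0 & K * (u ^+ 2) `^ gam <= phi.[2^-1 - u]]].
Proof.
move=> gam0 eps0.
have [N1 /(_ (N1 + 1)%N (leq_addr _ _))] := nat_powR_large (32 * K) gam0.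
set L := (N1 + 1)%N => LK.
have L1 : 1 <= L%:R :> R by rewrite ler1n /L addn1.
have [N2 N2P] := nat_powR_large (4 ^+ L.+1 * expR L%:R / eps) gam0.
have [N3 N3P] := nat_powR_large (eps ^- 2) (ltr01 : 0 < (1 : R)).
pose m := maxn (maxn N N2) (maxn N3 L.+1).
have [Nm N2m N3m LSm] :
    [/\ (N <= m)%N, (N2 <= m)%N, (N3 <= m)%N & (L.+1 <= m)%N].
  by rewrite !leq_max !leqnn !orbT.
have m0 : 0 < m%:R :> R by rewrite ltr0n (leq_trans _ LSm).
pose n := (m + L.+1.*2)%N.
have mn : (m <= n)%N by apply: leq_addr.
have n0 : 0 < n%:R :> R by rewrite (lt_le_trans m0)// ler_nat.
pose t : R := Num.sqrt (2 * L%:R / m%:R).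
have t2 : t ^+ 2 = 2 * L%:R / m%:R.
  by rewrite sqr_sqrtr// divr_ge0// ?mulr_ge0// ltW.
have tL : m%:R * t ^+ 2 = 2 * L%:R by rewrite t2; field; rewrite gt_eqF.
have t0 : 0 < t by rewrite sqrtr_gt0 divr_gt0// mulr_gt0//; lra.
(* The argument of the oscillation at [1/2 - u] is about [2 t u m = 1/2]. *)
pose u : R := (4 * t * m%:R)^-1.
have u0 : 0 < u by rewrite invr_gt0 !mulr_gt0.
have u2 : u ^+ 2 = (32 * L%:R * m%:R)^-1.
  by rewrite /u exprVn; congr (_^-1); ring: tL.
pose w : R := n%:R^-1 `^ gam.
have w0 : 0 < w by rewrite powR_gt0// invr_gt0.
exists n, ((w / 4) *: ((4 *: ('X * (1 - 'X))) ^+ L.+1 * oscillation m t)), u.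
have Lm : L.+1%:R <= m%:R :> R by rewrite ler_nat.
have L2 : L.+1%:R <= 2 * L%:R :> R by rewrite -natr1; lra.
have u2m : u ^+ 2 * (32 * L%:R * m%:R) = 1.
  by rewrite u2 mulVf// gt_eqF// !mulr_gt0//; lra.
have u2s : 0 <= u ^+ 2 by apply: sqr_ge0.
have m1 : 1 <= m%:R :> R by rewrite ler1n -(ltr0n R).
have Lm1 : 1 <= L%:R * m%:R :> R by rewrite mulr_ege1.
have u2le : u ^+ 2 * m%:R <= 1 by nra.
split.
- exact: leq_trans Nm mn.
- rewrite u0 /= -ler_sqr ?nnegrE ?ltW//; nra.
- rewrite -ler_sqr ?nnegrE ?ltW//.
  have := N3P m N3m; rewrite powRr1 ?(ltW m0)//.
  rewrite -(ler_pM2l (exprn_gt0 2 eps0)) mulfV ?gt_eqF ?exprn_gt0//; nra.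
- have w4 : 0 <= w / 4 by rewrite divr_ge0// ltW.
  have := bernstein_boundedZ w4 (bernstein_bounded_bumpX L.+1 (expR_ge0 L%:R)
    (oscillation_bounded tL)).
  apply: bernstein_boundedW => //.
  have := N2P n (leq_trans N2m mn); rewrite ler_pdivrMr//.
  rewrite -(ler_pM2l w0) [w * (_ `^ _ * _)]mulrA -powRM ?invr_ge0 ?(ltW n0)// mulVf ?gt_eqF//.
  rewrite powR1 mul1r => H; apply: le_trans H.
  rewrite ler_wpM2r ?mulr_ge0 ?exprn_ge0 ?expR_ge0//; lra.
split.
- move=> x x01; rewrite hornerZ normrM ger0_norm ?divr_ge0 ?(ltW w0)// -/w.
  have := ler_wpM2l (ltW w0) (bump_oscillation_le tL x01); lra.
- by rewrite hornerZ hornerM oscillation_half !mulr0.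
rewrite hornerZ hornerM horner_exp oscillationE !hornerE /=.
have -> : t * (1 - 2 * (2^-1 - u)) = 2 * t * u by field.
have b0 : 0 <= 2 * t * u by rewrite !mulr_ge0 ?ltW.
have mb : m%:R * (2 * t * u) = 2^-1.
  by rewrite /u; field; rewrite !gt_eqF.
have := @Im_expr_ge _ m _ b0; rewrite mb lexx => /(_ isT).
set r := complex.Im _ => r4.
(* The factor [4 x (1 - x) = 1 - 4 u ^ 2] is close enough to [1] for its power
   to stay away from [0]. *)
have y34 : 2^-1 <= (4 * (2^-1 - u) * (1 - (2^-1 - u))) ^+ L.+1.
  have -> : 4 * (2^-1 - u) * (1 - (2^-1 - u)) = 1 - 4 * u ^+ 2 by field.
  apply: le_trans (bernoulli_ineq _ _); last by apply/andP; split; nra.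
  nra.
(* Since [n <= 3 m], the amplitude [w] is at least [(L * u ^ 2) `^ gam]. *)
have wK : 32 * K * (u ^+ 2) `^ gam <= w.
  apply: (@le_trans _ _ ((L%:R * u ^+ 2) `^ gam)).
    by rewrite powRM// ler_wpM2r// powR_ge0.
  apply: ge0_ler_powR;
    rewrite ?nnegrE ?invr_ge0 ?mulr_ge0 ?(ltW gam0) ?(ltW n0) ?(ltW u0)//.
    rewrite -(ler_pM2r n0) mulVf ?gt_eqF//.
  have : n%:R <= 3 * m%:R :> R; last by nra.
  by rewrite /n natrD -muln2 natrM; lra.
set y := _ ^+ _ in y34 *.
have yr : 8^-1 <= y * r by nra.
have := ler_wpM2l (ltW w0) yr; lra.
Qed.

(** * Superposition of humps *)

(** A partial sum of humps, the degree of its last hump, and the distance to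
    [1/2] at which the increment of that hump is large. *)
Record stage (R : realType) :=
  Stage { approximant : {poly R}; level : nat; gap : R }.

(** The margin [delta] is what the next humps may consume without leaving the
    cone. *)
Definition stage_ok (R : realType) (s : stage R) :=
  [/\ (0 < level s)%N, 0 < gap s <= 2^-1 &
      exists2 delta, 0 < delta &
        bernstein_cone (level s) (approximant s - delta%:P)].

(** The second bound on [w (level s')] keeps the later humps from spoiling the
    increment of [approximant s] at distance [gap s]; the factor
    [(gap s)^-1] in front of the increment is only a convenient quantity that
    tends to infinity along the construction. *)
Definition next_stage (R : realType) (gam : R) (s s' : stage R) :=
  let w n : R := n%:R^-1 `^ gam in
  [/\ (level s < level s')%N, gap s' <= gap s / 2,
      w (level s') <= w (level s) / 2,
      w (level s') <= (gap s ^+ 2) `^ gam &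
    [/\ forall x, 0 <= x <= 1 ->
          `|(approximant s').[x] - (approximant s).[x]| <= x * (1 - x) * w (level s') &
        (gap s)^-1 * (gap s' ^+ 2) `^ gam <=
          `|(approximant s').[2^-1 - gap s'] - (approximant s').[2^-1]|]].

Lemma bernstein_boundedN (R : realType) (d : nat) (M : R) (p : {poly R}) :
  bernstein_bounded d M p -> bernstein_bounded d M (- p).
Proof. by case=> p1 p2; split; rewrite ?opprK. Qed.

Lemma next_stage_ex (R : realType) (gam : R) (s : stage R) :
  0 < gam -> stage_ok s ->
  exists s', stage_ok s' /\ next_stage gam s s'.
Proof.
case: s => F n u gam0 [/= n0 /andP[u0 u1] [delta delta0 Fd]].
pose w k : R := k%:R^-1 `^ gam.
have w0 k : (0 < k)%N -> 0 < w k.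
  by move=> k0; rewrite powR_gt0// invr_gt0 ltr0n.
have weps e : 0 < e -> exists N, forall k, (N <= k)%N -> (0 < k)%N -> w k <= e.
  move=> e0; have [N NP] := nat_powR_large e^-1 gam0.
  exists N => k Nk k0; have := NP k Nk.
  rewrite -(ler_pM2l (w0 _ k0)) -powRM ?invr_ge0// mulVf ?pnatr_eq0 -?lt0n//.
  by rewrite powR1 ler_pdivrMr// mul1r.
have [N1 N1P] := weps (w n / 2) ltac:(by rewrite divr_gt0// w0).
have [N2 N2P] := weps ((u ^+ 2) `^ gam) ltac:(by rewrite powR_gt0// exprn_gt0).
have eps0 : 0 < Num.min (delta / 2) (u / 2) by rewrite lt_min !divr_gt0.
have [n' [phi [u' [nn' u'0 u'e phiB [phile phi0 phige]]]]] :=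
  hump (maxn n.+1 (maxn N1 N2)) u^-1 gam0 eps0.
move: nn'; rewrite !geq_max => /and3P[nn' N1n' N2n'].
have n'0 : (0 < n')%N by apply: leq_trans nn'.
(* The hump, or its opposite, is used according to the sign of the increment
   [D] already present, so that the two increments add up. *)
pose D := F.[2^-1 - u'] - F.[2^-1].
have [psi [psiB psile psi0 psige]] : exists psi : {poly R},
    [/\ bernstein_bounded n' (Num.min (delta / 2) (u / 2)) psi,
        forall x, 0 <= x <= 1 -> `|psi.[x]| <= x * (1 - x) * w n',
        psi.[2^-1] = 0 & phi.[2^-1 - u'] <= `|D + psi.[2^-1 - u']|].
  have [D0|D0] := leP 0 D.
    by exists phi; split => //; apply: le_trans (ler_norm _); rewrite lerDr.
  exists (- phi); split.
  - exact: bernstein_boundedN.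
  - by move=> x x01; rewrite hornerN normrN phile.
  - by rewrite hornerN phi0 oppr0.
  - by rewrite hornerN -normrN; apply: le_trans (ler_norm _); lra.
exists (Stage (F + psi) n' u'); split; first split => //=.
  exists (delta / 2); first by rewrite divr_gt0.
  have -> : F + psi - (delta / 2)%:P =
      (F - delta%:P) + ((delta / 2)%:P + psi).
    by rewrite {2}[delta]splitr polyCD; ring.
  apply: coneD; first exact: cone_elevation (ltnW nn') Fd.
  have mle : Num.min (delta / 2) (u / 2) <= delta / 2 by rewrite ge_min lexx.
  by have [] := bernstein_boundedW (leqnn _) mle psiB.
split => //=.
- by apply: le_trans u'e _; rewrite ge_min lexx orbT.
- exact: N1P.
- exact: N2P.
split; first by move=> x x01; rewrite hornerD addrC addKr psile.
apply: le_trans phige _; apply: le_trans psige _.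
by rewrite !hornerD psi0 /D addr0 addrAC.
Qed.

(** The intervals [[v j - 2 * e j, v j + 2 * e j]] are nested, and the limit is
    the supremum of their left ends. *)
Lemma halving_limit (R : realType) (v e : nat -> R) :
  (forall j, `|v j.+1 - v j| <= e j) -> (forall j, e j.+1 <= e j / 2) ->
  exists l, forall j, `|l - v j| <= 2 * e j.
Proof.
move=> ve e2.
have e0 j : 0 <= e j by apply: le_trans (ve j).
have lo i k : v i - 2 * e i <= v (i + k)%N - 2 * e (i + k)%N.
  elim: k => [|k IH]; first by rewrite addn0.
  rewrite addnS; apply: le_trans IH _.
  have := ve (i + k)%N; have := e2 (i + k)%N; rewrite ler_norml; lra.
have hi i k : v (i + k)%N + 2 * e (i + k)%N <= v i + 2 * e i.
  elim: k => [|k IH]; first by rewrite addn0.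
  rewrite addnS; apply: le_trans IH.
  have := ve (i + k)%N; have := e2 (i + k)%N; rewrite ler_norml; lra.
pose E := range (fun j => v j - 2 * e j).
have Eub j : ubound E (v j + 2 * e j).
  move=> _ [i _ <-]; have := lo i j; have := hi j i; rewrite addnC.
  have := e0 (i + j)%N; lra.
exists (sup E) => j.
have E1 : sup E <= v j + 2 * e j.
  by apply: ge_sup => //; exists (v 0%N - 2 * e 0%N), 0%N.
have E2 : v j - 2 * e j <= sup E.
  by apply: ub_le_sup; [exists (v 0%N + 2 * e 0%N)|exists j].
rewrite ler_norml; lra.
Qed.

(** * Comparison with the Hoelder scale *)

(** As [x (1 - x) <= 1], it is at most its power of exponent [alpha / 2 <= 1];
    the first term of the maximum in [Delta] is then enough. *)
Lemma powR_Delta_ge (R : realType) (alpha x : R) (n : nat) :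
  0 < alpha -> alpha <= 2 -> (0 < n)%N -> 0 <= x <= 1 ->
  x * (1 - x) * n%:R^-1 `^ (alpha / 2) <= Delta n x `^ alpha.
Proof.
move=> alpha0 alpha2 n0 /andP[x0 x1].
have y0 : 0 <= x * (1 - x) by rewrite mulr_ge0// subr_ge0.
have z0 : 0 <= x * (1 - x) / n%:R by rewrite divr_ge0.
apply: (@le_trans _ _ (Num.sqrt (x * (1 - x) / n%:R) `^ alpha)); last first.
  apply: ge0_ler_powR; rewrite ?nnegrE ?sqrtr_ge0 ?(ltW alpha0)//.
    by rewrite le_max sqrtr_ge0.
  by rewrite le_max lexx.
rewrite -powR12_sqrt// -powRrM [2^-1 * _]mulrC powRM ?invr_ge0//.
rewrite ler_wpM2r ?powR_ge0//.
have [->|yn0] := eqVneq (x * (1 - x)) 0; first exact: powR_ge0.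
apply: ger1_powR; last by rewrite ler_pdivrMr// mul1r.
rewrite lt_neqAle eq_sym yn0 y0/=; nra.
Qed.

(** Two points at distance [u] have to be compared at a scale [h > u]; the
    choice [h = 2 * u] only costs a factor [2 `^ alpha]. *)
Lemma not_holder (R : realType) (alpha : R) (f : R -> R) :
  (forall B e : R, 0 < e -> exists u : R, [/\ 0 < u <= 2^-1, u < e &
     B * u `^ alpha < `|f (2^-1 - u) - f 2^-1|]) ->
  ~ holder_class alpha f.
Proof.
move=> fbig [M [e /= e0 eM]].
have [u [/andP[u0 u1] ue]] :=
  fbig (M * 2 `^ alpha) (e / 2) ltac:(by rewrite divr_gt0).
apply/negP; rewrite -leNgt -mulrA -powRM ?(ltW u0)//.
have h0 : 0 < 2 * u by rewrite mulr_gt0.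
have := eM (2 * u); rewrite /= sub0r normrN gtr0_norm// => /(_ _ h0).
rewrite mulrC -ltr_pdivlMr// => /(_ ue); rewrite mulrC => Mh.
rewrite -lee_fin; apply: le_trans Mh; apply: ereal_sup_ubound.
exists (2^-1 - u), 2^-1; split=> //; rewrite ?in_itv/=.
- by apply/andP; split; lra.
- by apply/andP; split; lra.
- by rewrite addrAC subrr sub0r normrN gtr0_norm//; lra.
Qed.

Theorem mainTheorem3 (R : realType) (alpha : R)
    (alpha_gt0 : 0 < alpha) (alpha_lt1 : alpha < 1) :
  exists (f : R -> R) (q : nat -> {poly R}) (C : R),
    [/\ ~ holder_class alpha f,
        forall n : nat, (1 <= n)%N -> bernstein_cone n (q n) &
        forall (n : nat) (x : R), (1 <= n)%N -> x \in `[0, 1] ->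
          `|f x - (q n).[x]| <= C * (Delta n x) `^ alpha].
Proof.
pose gam := alpha / 2.
have gam0 : 0 < gam by rewrite divr_gt0.
pose w n : R := n%:R^-1 `^ gam.
have next_ex s : exists s', stage_ok s -> stage_ok s' /\ next_stage gam s s'.
  have [|sN] := pselect (stage_ok s); last by exists s.
  by move=> /(next_stage_ex gam0)[s' sP]; exists s'.
have [next nextP] := choice next_ex.
pose S j := iter j next (Stage 1 1 2^-1).
have Sok j : stage_ok (S j).
  elim: j => [|j /nextP[]//]; split => //=; first by rewrite invr_gt0 ltr0n lexx.
  exists 2^-1; first by rewrite invr_gt0.
  by rewrite -polyC1 -polyCB; apply: coneC; lra.
have Snext j : next_stage gam (S j) (S j.+1) by have [] := nextP _ (Sok j).
have gap0 j : 0 < gap (S j) <= 2^-1 by have [] := Sok j.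
have gapj j : gap (S j) * j.+2%:R <= 1.
  elim: j => [|j IH]; first by rewrite /= mulVf.
  have [_ rS _ _ _] := Snext j; have /andP[r0 _] := gap0 j.
  apply: le_trans IH; apply: le_trans (ler_wpM2r _ rS) _ => //.
  rewrite -mulrA ler_wpM2l ?(ltW r0)// -[j.+3%:R]natr1.
  have : 1 <= j.+2%:R :> R by rewrite ler1n.
  lra.
have lev_gt j : (j < level (S j))%N.
  elim: j => [//|j IH]; have [lS _ _ _ _] := Snext j.
  exact: leq_ltn_trans IH lS.
have [f fP] : exists f : R -> R, forall x, 0 <= x <= 1 -> forall j,
    `|f x - (approximant (S j)).[x]| <= 2 * (x * (1 - x) * w (level (S j.+1))).
  have lim x : exists l, 0 <= x <= 1 -> forall j,
      `|l - (approximant (S j)).[x]| <= 2 * (x * (1 - x) * w (level (S j.+1))).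
    have [x01|] := boolP (0 <= x <= 1); last by exists 0.
    have [||l lP] := @halving_limit R (fun j => (approximant (S j)).[x])
      (fun j => x * (1 - x) * w (level (S j.+1))); last by exists l.
    - by move=> j; have [_ _ _ _ [+ _]] := Snext j; apply.
    - move=> j; have [_ _ wS _ _] := Snext j.+1.
      rewrite -[leRHS]mulrA ler_wpM2l//.
      by case/andP: x01 => x0 x1; rewrite mulr_ge0// subr_ge0.
  by have [f fP] := choice lim; exists f.
(* [J n] is the last stage whose degree is at most [n]. *)
have [J JP] : exists J : nat -> nat, forall n, (1 <= n)%N ->
    (level (S (J n)) <= n < level (S (J n).+1))%N.
  have exJ n : exists j, (1 <= n)%N ->
      (level (S j) <= n < level (S j.+1))%N.
    have [n1|] := boolP (1 <= n)%N; last by exists 0%N.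
    have exP : exists j, (level (S j) <= n)%N by exists 0%N.
    have ubP j : (level (S j) <= n)%N -> (j <= n)%N.
      by apply: leq_trans; apply: ltnW.
    case: (ex_maxnP exP ubP) => j jn jmax; exists j => _.
    by rewrite jn ltnNge; apply/negP => /jmax; rewrite ltnn.
  by (* [J n] is the last stage whose degree is at most [n]. *)
have [J JP] := choice exJ; exists J.
exists f, (fun n => approximant (S (J n))), 2; split.
- apply: not_holder => B e e0.
  pose k := Num.bound (Num.max (B + 1) e^-1).
  have kB : Num.max (B + 1) e^-1 < k%:R.
    by apply: archi_boundP; rewrite le_max invr_ge0 (ltW e0) orbT.
  move: kB; rewrite gt_max => /andP[kB ke].
  have [_ rS _ _ [_ jump]] := Snext k; have [_ _ _ wr _] := Snext k.+1.
  have /andP[r0 _] := gap0 k; have /andP[r0' r1'] := gap0 k.+1.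
  set u := gap (S k.+1) in jump wr rS r0' r1' *.
  have rk : k%:R <= (gap (S k))^-1.
    rewrite -[leRHS]mul1r ler_pdivlMr// mulrC; apply: le_trans (gapj k).
    by rewrite ler_wpM2l ?(ltW r0)// ler_nat -addn2 leq_addr.
  have ua : (u ^+ 2) `^ gam = u `^ alpha.
    rewrite -powR_mulrn ?(ltW r0')// -powRrM /gam; congr (_ `^ _).
    by rewrite mulrC divfK.
  have ua0 : 0 < u `^ alpha by rewrite powR_gt0.
  rewrite ua in jump wr.
  exists u; split; first by rewrite r0'.
    have re : gap (S k) < e.
      rewrite -[e]invrK -[gap _]invrK ltf_pV2 ?posrE ?invr_gt0//.
      exact: lt_le_trans ke rk.
    by lra.
  have near_u y : 0 <= y <= 1 ->
      `|f y - (approximant (S k.+1)).[y]| <= u `^ alpha / 2.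
    move=> y01; apply: le_trans (fP y y01 k.+1) _.
    have y4 : 0 <= y * (1 - y) <= 4^-1.
      case/andP: y01 => y0 y1; have := sqr_ge0 (1 - 2 * y).
      by move=> y2; apply/andP; split; nra.
    case/andP: y4 => y4 /(ler_wpM2r (ltW ua0)); have := ler_wpM2l y4 wr.
    rewrite -/(w _); lra.
  have n1 := near_u (2^-1 - u) ltac:(apply/andP; split; lra).
  have n2 := near_u 2^-1 ltac:(apply/andP; split; lra).
  (* The increment of stage [k + 1] beats [(B + 1) * u `^ alpha], and the later
     stages change it by at most [u `^ alpha]. *)
  have main : B * u `^ alpha + u `^ alpha < (gap (S k))^-1 * u `^ alpha.
    by rewrite -[X in _ + X]mul1r -mulrDl ltr_pM2r//; apply: lt_le_trans rk.
  move: main jump n1 n2; set g := approximant _; set b := _ * _; set c := _^-1 * _.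
  move=> main jump n1 n2.
  have t1 := ler_normD (g.[2^-1 - u] - f (2^-1 - u) + (f 2^-1 - g.[2^-1]))
    (f (2^-1 - u) - f 2^-1).
  have t2 := ler_normD (g.[2^-1 - u] - f (2^-1 - u)) (f 2^-1 - g.[2^-1]).
  rewrite [X in `|X| <= _ + `|f (2^-1 - u) - _|]
    (_ : _ = g.[2^-1 - u] - g.[2^-1]) in t1; last by ring.
  rewrite [`|g.[_] - f _|]distrC in t2.
  lra.
- move=> n n1; have [_ _ [delta delta0 Fd]] := Sok (J n).
  have /andP[Jn _] := JP n n1.
  rewrite -(subrK delta%:P (approximant _)); apply: coneD; last first.
    exact/coneC/ltW.
  exact: cone_elevation Fd.
- move=> n x n1; rewrite in_itv /= => x01.
  have /andP[_ nJ] := JP n n1.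
  apply: le_trans (fP x x01 (J n)) _; rewrite ler_wpM2l//.
  have alpha2 : alpha <= 2 by lra.
  apply: le_trans (powR_Delta_ge alpha_gt0 alpha2 n1 x01).
  rewrite ler_wpM2l//.
    by case/andP: x01 => x0 x1; rewrite mulr_ge0// subr_ge0.
  apply: ge0_ler_powR; rewrite ?nnegrE ?invr_ge0// ?(ltW gam0)//.
  by rewrite lef_pV2 ?posrE ?ltr0n ?(leq_trans n1 (ltnW nJ))// ler_nat ltnW.
Qed.
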